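(* Let $L$ be a loop with Nuclear-holomorph $H(L)$. Then $L$ is an IP-CC-SIP-SCCL if and only if $H(L)$ is an IP-CC-SIP-SCCL.
   Context: Mappings are written on the right, so $\alpha\beta$ means first $\alpha$, then $\beta$. For a loop $(L,\cdot)$ let $Aum(L,\cdot)$ be its automorphism group. The holomorph $H(L)=(H,\circ)$ is the loop on the set $H$ of pairs $(\alpha,x)$ with $\alpha\in Aum(L,\cdot)$, $x\in L$, with operation $(\alpha,x)\circ(\beta,y)=(\alpha\beta,\ x\beta\cdot y)$. The symbol $x^{-1}$ denotes the two-sided inverse of $x$ (assumed to exist in $L$). The nucleus $N(L)$ is the set of $a\in L$ with $a\cdot xy=ax\cdot y$, $x\cdot ay=xa\cdot y$, $x\cdot ya=xy\cdot a$ for all $x,y\in L$. $H(L)$ is called a Nuclear-holomorph of $L$ if $x^{-1}\cdot x\alpha\in N(L)$ or $x\alpha\cdot x^{-1}\in N(L)$ for all $x\in L$ and $\alpha\in Aum(L,\cdot)$. A loop is an inverse property loop (IPL) if every element $x$ has an inverse $x^{-1}$ such that $x^{-1}\cdot(x\cdot y)=y=(y\cdot x)\cdot x^{-1}$ for all $y$. A loop is a conjugacy closed loop (CC-loop) if its set of left translations is closed under conjugation by left translations and its set of right translations is closed under conjugation by right translations (in each case including conjugation by inverses of translations). A loop is a SIPL (resp. SCCL) if it has at least one non-trivial subloop that is an IPL (resp. a CC-loop). An IP-CC-SIP-SCCL is a loop that is an IPL, a CC-loop, a SIPL and a SCCL. *)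

(* Defs.v *)
From HB Require Import structures.
From mathcomp Require Import all_boot.
From Stdlib Require Import FunctionalExtensionality ProofIrrelevance.

Set Implicit Arguments.
Unset Strict Implicit.
Unset Printing Implicit Defensive.

Local Open Scope group_scope.

(* Loops in equational form: [ldiv a b] and [rdiv b a] are the unique solutions
   of [a * x = b] and [y * a = b]. Carriers are arbitrary types, neither finite
   nor equipped with a choice operator. *)
HB.mixin Record isLoop L of BaseUMagma L := {
  ldiv : L -> L -> L;
  rdiv : L -> L -> L;
  lmul1 : forall x : L, 1 * x = x;
  lmulr1 : forall x : L, x * 1 = x;
  mul_ldiv : forall x y : L, x * ldiv x y = y;
  ldiv_mul : forall x y : L, ldiv x (x * y) = y;
  rdiv_mul : forall x y : L, rdiv y x * x = y;
  mul_rdiv : forall x y : L, rdiv (y * x) x = y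
}.

#[short(type="loopType")]
HB.structure Definition Loop := {L of isLoop L & BaseUMagma L}.

(* The inverse mapping is a field so that the automorphism group needs no choice
   principle; it is determined by [autf] (see [aut_eq]). *)
Record automorphism (L : loopType) := Automorphism {
  autf :> L -> L;
  autinv : L -> L;
  autfK : cancel autf autinv;
  autinvK : cancel autinv autf;
  autM : {morph autf : x y / x * y}
}.

Lemma aut_eq (L : loopType) (a b : automorphism L) : a =1 b -> a = b.
Proof.
case: a b => [f f' fK f'K fM] [g g' gK g'K gM] /= fg.
have {fg} efg : f = g by exact: functional_extensionality.
subst g.
have efg' : f' = g'.
  by apply: functional_extensionality => x; rewrite -{1}[x]g'K fK.
subst g'.
by congr Automorphism; exact: proof_irrelevance.
Qed.

Section AutomorphismGroup.
Variable L : loopType.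
Implicit Types a b : automorphism L.

Definition aut1 : automorphism L :=
  @Automorphism L id id (fun=> erefl) (fun=> erefl) (fun _ _ => erefl).

(* Mappings act on the right: first [a], then [b]. *)
Definition aut_mul a b : automorphism L.
Proof.
refine (@Automorphism L (fun x => b (a x)) (fun x => autinv a (autinv b x)) _ _ _).
- by move=> x; rewrite !autfK.
- by move=> x; rewrite !autinvK.
- by move=> x y; rewrite !autM.
Defined.

Definition aut_inv a : automorphism L.
Proof.
refine (@Automorphism L (autinv a) a (@autinvK L a) (@autfK L a) _).
by move=> x y; apply: (can_inj (@autfK L a)); rewrite autM !autinvK.
Defined.

End AutomorphismGroup.

(* An alias, so that it does not inherit a componentwise product. *)
Definition holomorph (L : loopType) : Type := (automorphism L * L)%type.

Section Holomorph.
Variable L : loopType.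
Local Notation H := (holomorph L).

Definition holo_mul (u v : H) : H := (aut_mul u.1 v.1, v.1 u.2 * v.2).
Definition holo_one : H := (aut1 L, 1).

HB.instance Definition _ := hasMul.Build H holo_mul.
HB.instance Definition _ := hasOne.Build H holo_one.

Definition holo_ldiv (u w : H) : H :=
  let b := aut_mul (aut_inv u.1) w.1 in (b, ldiv (b u.2) w.2).
Definition holo_rdiv (w v : H) : H :=
  (aut_mul w.1 (aut_inv v.1), autinv v.1 (rdiv w.2 v.2)).

Fact holo_mul1 (u : H) : 1 * u = u.
Proof.
case: u => a x; congr pair; first exact: aut_eq.
have a1 : a 1 = 1.
  by rewrite -[LHS](ldiv_mul (a 1)) -autM lmul1 -{2}[a 1]lmulr1 ldiv_mul.
by rewrite /= a1 lmul1.
Qed.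

Fact holo_mulr1 (u : H) : u * 1 = u.
Proof.
by case: u => a x; congr pair; [exact: aut_eq | exact: lmulr1].
Qed.

Fact holo_mul_ldiv (u w : H) : u * holo_ldiv u w = w.
Proof.
case: u w => [a x] [c z]; congr pair; last exact: mul_ldiv.
by apply: aut_eq => t /=; rewrite autfK.
Qed.

Fact holo_ldiv_mul (u v : H) : holo_ldiv u (u * v) = v.
Proof.
case: u v => [a x] [b y]; congr pair.
  by apply: aut_eq => t /=; rewrite autinvK.
by rewrite /= autinvK ldiv_mul.
Qed.

Fact holo_rdiv_mul (v w : H) : holo_rdiv w v * v = w.
Proof.
case: v w => [b y] [c z]; congr pair.
  by apply: aut_eq => t /=; rewrite autinvK.
by rewrite /= autinvK rdiv_mul.
Qed.

Fact holo_mul_rdiv (v u : H) : holo_rdiv (u * v) v = u.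
Proof.
case: v u => [b y] [a x]; congr pair.
  by apply: aut_eq => t /=; rewrite autfK.
by rewrite /= mul_rdiv autfK.
Qed.

HB.instance Definition _ := isLoop.Build H holo_mul1 holo_mulr1
  holo_mul_ldiv holo_ldiv_mul holo_rdiv_mul holo_mul_rdiv.

End Holomorph.

Record subloop (L : loopType) := Subloop {
  submem :> L -> Prop;
  submem1 : submem 1;
  submemM : forall x y, submem x -> submem y -> submem (x * y);
  submem_ldiv : forall x y, submem x -> submem y -> submem (ldiv x y);
  submem_rdiv : forall x y, submem x -> submem y -> submem (rdiv x y)
}.

Definition subloop_type (L : loopType) (S : subloop L) : Type := {x : L | S x}.

Section SubloopLoop.
Variables (L : loopType) (S : subloop L).
Local Notation T := (subloop_type S).

Definition sub_mul (x y : T) : T :=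
  exist _ (sval x * sval y) (submemM (svalP x) (svalP y)).
Definition sub_one : T := exist _ 1 (submem1 S).
Definition sub_ldiv (x y : T) : T :=
  exist _ (ldiv (sval x) (sval y)) (submem_ldiv (svalP x) (svalP y)).
Definition sub_rdiv (x y : T) : T :=
  exist _ (rdiv (sval x) (sval y)) (submem_rdiv (svalP x) (svalP y)).

HB.instance Definition _ := hasMul.Build T sub_mul.
HB.instance Definition _ := hasOne.Build T sub_one.

Fact sub_eq (x y : T) : sval x = sval y -> x = y.
Proof.
case: x y => [x Sx] [y Sy] /= exy; subst y.
by congr exist; exact: proof_irrelevance.
Qed.

Fact sub_mul1 (x : T) : 1 * x = x.
Proof. by apply: sub_eq; exact: lmul1. Qed.
Fact sub_mulr1 (x : T) : x * 1 = x.
Proof. by apply: sub_eq; exact: lmulr1. Qed.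
Fact sub_mul_ldiv (x y : T) : x * sub_ldiv x y = y.
Proof. by apply: sub_eq; exact: mul_ldiv. Qed.
Fact sub_ldiv_mul (x y : T) : sub_ldiv x (x * y) = y.
Proof. by apply: sub_eq; exact: ldiv_mul. Qed.
Fact sub_rdiv_mul (x y : T) : sub_rdiv y x * x = y.
Proof. by apply: sub_eq; exact: rdiv_mul. Qed.
Fact sub_mul_rdiv (x y : T) : sub_rdiv (y * x) x = y.
Proof. by apply: sub_eq; exact: mul_rdiv. Qed.

HB.instance Definition _ := isLoop.Build T sub_mul1 sub_mulr1
  sub_mul_ldiv sub_ldiv_mul sub_rdiv_mul sub_mul_rdiv.

End SubloopLoop.

(* Non-trivial means different from {1}; the whole loop is allowed. *)
Definition nontrivial (L : loopType) (S : subloop L) : Prop :=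
  exists2 x : L, S x & x <> 1.

Definition is_inverse (L : loopType) (x x' : L) : Prop :=
  x * x' = 1 /\ x' * x = 1.

Definition has_inverses (L : loopType) : Prop :=
  forall x : L, exists x' : L, is_inverse x x'.

Definition in_nucleus (L : loopType) (a : L) : Prop :=
  forall x y : L,
    [/\ a * (x * y) = (a * x) * y,
        x * (a * y) = (x * a) * y
      & x * (y * a) = (x * y) * a].

(* A two-sided inverse is unique when it exists, so [x'] is x^-1. *)
Definition nuclear_holomorph (L : loopType) : Prop :=
  forall (x x' : L) (a : automorphism L), is_inverse x x' ->
    in_nucleus (x' * a x) \/ in_nucleus (a x * x').

Definition IPL (L : loopType) : Prop :=
  forall x : L, exists2 x' : L, is_inverse x x' &
    forall y : L, x' * (x * y) = y /\ (y * x) * x' = y.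

Definition left_translation (L : loopType) (f : L -> L) : Prop :=
  exists x : L, f =1 (fun y => x * y).

Definition right_translation (L : loopType) (f : L -> L) : Prop :=
  exists x : L, f =1 (fun y => y * x).

Definition conjugation_closed (T : Type) (A : (T -> T) -> Prop) : Prop :=
  forall f f' g : T -> T, A f -> A g -> cancel f f' -> cancel f' f ->
    A (fun x => f' (g (f x))) /\ A (fun x => f (g (f' x))).

Definition CCL (L : loopType) : Prop :=
  conjugation_closed (@left_translation L)
  /\ conjugation_closed (@right_translation L).

Definition SIPL (L : loopType) : Prop :=
  exists S : subloop L, nontrivial S /\ IPL (subloop_type S).

Definition SCCL (L : loopType) : Prop :=
  exists S : subloop L, nontrivial S /\ CCL (subloop_type S).

Definition IP_CC_SIP_SCCL (L : loopType) : Prop :=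
  [/\ IPL L, CCL L, SIPL L & SCCL L].

(* Main.v *)
Require Import Defs.
From mathcomp Require Import all_boot.
From Stdlib Require Import Classical.

(** Call [v * x = x * y] a conjugacy between [v] and [y] through [x]. A loop is
    conjugacy closed exactly when every conjugacy lifts from elements to
    translations: [x * (y * t) = v * (x * t)] and [(t * v) * x = (t * x) * y]
    for every [t] ([CCL_conjugacy]).

    In the holomorph the same two identities, read on second coordinates, become
    twisted identities of [L]: one occurrence of [x] is replaced by its image
    [x'] under some automorphism. If the holomorph is nuclear and [L] has the
    inverse property, then [x'] is [x * n] or [n * x] with [n] in the nucleus,
    and such an [n] can be moved through brackets and absorbed by [y] or by [v].
    Hence the twisted identities reduce to the untwisted ones
    ([conjugacy_nuclear_shift]), and the holomorph is conjugacy closed. The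
    inverse property goes up to the holomorph by direct computation.

    Conversely both properties are inherited along injective homomorphisms, and
    [x |-> (1, x)] embeds [L] into its holomorph. Finally the conditions on
    subloops say no more than that the loop is nontrivial, since the whole loop
    is one of its own subloops; and [L] is nontrivial if and only if its holomorph
    is, because a loop with one element has only the identity automorphism. *)

Set Implicit Arguments.
Unset Strict Implicit.
Unset Printing Implicit Defensive.

Local Open Scope group_scope.

Section LoopTheory.
Variable L : loopType.
Implicit Types x y z t v n : L.

Lemma loop_mulI x : injective (fun y => x * y).
Proof. by move=> y z /= e; rewrite -(ldiv_mul x y) e ldiv_mul. Qed.

Lemma loop_mulIr x : injective (fun y => y * x).
Proof. by move=> y z /= e; rewrite -(mul_rdiv x y) e mul_rdiv. Qed.

Lemma morph_loop1 (M : loopType) (f : M -> L) :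
  {morph f : x y / x * y} -> f 1 = 1.
Proof. by move=> fM; apply: (@loop_mulI (f 1)); rewrite -fM !lmulr1. Qed.

(** The case [y = 1] of the two cancellation laws already says that [x'] is a
    two-sided inverse of [x]. *)
Lemma IPL_cancel :
  IPL L <-> forall x, exists x', forall y, x' * (x * y) = y /\ (y * x) * x' = y.
Proof.
split=> ipL x.
  by have [x' _ h] := ipL x; exists x'.
have [x' h] := ipL x; exists x' => //; have [] := h 1.
by rewrite lmulr1 lmul1.
Qed.

Lemma IPL_inverse_cancel x x' z : IPL L -> is_inverse x x' ->
  x * (x' * z) = z /\ (z * x') * x = z.
Proof.
move=> ipL [xx' x'x]; have [x'' [_ x''x'] h] := ipL x'.
suff -> : x = x'' by exact: h.
by apply: (@loop_mulIr x'); rewrite xx' x''x'.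
Qed.

(** The two halves of conjugation closure, by [f^-1 g f] and by [f g f^-1], are
    covered by one relation [v * x = x * y]: it can be solved for [y] as well
    as for [v]. Which translation a conjugate is can be read off from its value at
    a single point. *)
Lemma CCL_conjugacy :
  CCL L <-> forall x y v, v * x = x * y ->
    forall t, x * (y * t) = v * (x * t) /\ (t * v) * x = (t * x) * y.
Proof.
split=> [[lcc rcc] x y v e t | cc].
- split.
  + have [||[z hz] _] := lcc (fun u => x * u) (ldiv x) (fun u => v * u) _ _
      (ldiv_mul x) (mul_ldiv x); [by exists x | by exists v |].
    have <- : z = y.
      by have := hz 1; rewrite !lmulr1 e ldiv_mul.
    by rewrite -hz mul_ldiv.
  + have [||_ [z hz]] := rcc (fun u => u * x) (fun u => rdiv u x)
      (fun u => u * v) _ _ (mul_rdiv x) (rdiv_mul x).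
    * by exists x.
    * by exists v.
    move: (hz (t * x)); rewrite mul_rdiv => ->.
    congr (_ * _); apply: (@loop_mulI x); rewrite -e.
    by move: (hz (1 * x)); rewrite mul_rdiv !lmul1.
- split=> f f' g [x fE] [v gE] fK f'K.
  + have f'E u : f' u = ldiv x u.
      by apply: (can_inj fK); rewrite f'K fE mul_ldiv.
    split.
    * exists (ldiv x (v * x)) => t; rewrite f'E gE fE.
      have [<- _] := cc x (ldiv x (v * x)) v (esym (mul_ldiv _ _)) t.
      by rewrite ldiv_mul.
    * exists (rdiv (x * v) x) => t; rewrite fE gE f'E.
      have [-> _] := cc x v (rdiv (x * v) x) (rdiv_mul _ _) (ldiv x t).
      by rewrite mul_ldiv.
  + have f'E u : f' u = rdiv u x.
      by apply: (can_inj fK); rewrite f'K fE rdiv_mul.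
    split.
    * exists (rdiv (x * v) x) => t; rewrite f'E gE fE.
      have [_ <-] := cc x v (rdiv (x * v) x) (rdiv_mul _ _) t.
      by rewrite mul_rdiv.
    * exists (ldiv x (v * x)) => t; rewrite fE gE f'E.
      have [_ ->] := cc x (ldiv x (v * x)) v (esym (mul_ldiv _ _)) (rdiv t x).
      by rewrite rdiv_mul.
Qed.

(** A nuclear [n] to the right of [x] is absorbed by [y], turning the hypothesis
    into a conjugacy between [v] and [n * y]. To the left of [x] it is absorbed
    by [v] instead: cancelling [x] gives [v = n * u], where [u] is conjugate to
    [y] through [x]. *)
Lemma conjugacy_nuclear_shift n x x' y v t : CCL L -> in_nucleus n ->
  x' = x * n \/ x' = n * x -> v * x = x' * y ->
  x' * (y * t) = v * (x * t) /\ (t * v) * x = (t * x') * y.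
Proof.
move=> /CCL_conjugacy cc nuc; case=> -> e.
- have [_ nxy _] := nuc x y; rewrite -nxy in e.
  have [<- ->] := cc _ _ _ e t.
  have [nyt nxyt _] := nuc y t; have [_ nxyt' _] := nuc x (y * t).
  have [_ ntxy ntx] := nuc (t * x) y; have [_ _ ntx'] := nuc t x.
  by rewrite -nyt nxyt' ntxy ntx'.
- pose u := rdiv (x * y) x; have eu : u * x = x * y by exact: rdiv_mul.
  have ev : v = n * u.
    apply: (@loop_mulIr x); have [<- _ _] := nuc u x.
    by rewrite e eu; have [-> _ _] := nuc x y.
  have [le _] := cc _ _ _ eu t; have [_ re] := cc _ _ _ eu (t * n).
  have [nxyt _ _] := nuc x (y * t); have [nuxt _ _] := nuc u (x * t).
  have [_ ntu _] := nuc t u; have [_ ntx _] := nuc t x.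
  by rewrite -nxyt le ev -nuxt ntu re ntx.
Qed.

Lemma nuclear_holomorph_shift x (a : automorphism L) :
  IPL L -> nuclear_holomorph L ->
  exists2 n, in_nucleus n & a x = x * n \/ a x = n * x.
Proof.
move=> ipL nucL; have [x' xx' _] := ipL x.
have [c1 c2] := IPL_inverse_cancel (a x) ipL xx'.
case: (nucL x x' a xx') => nuc.
- by exists (x' * a x) => //; left.
- by exists (a x * x') => //; right.
Qed.

Definition full_subloop : subloop L :=
  @Subloop L (fun=> True) I (fun _ _ _ _ => I) (fun _ _ _ _ => I)
    (fun _ _ _ _ => I).

End LoopTheory.

Section Embedding.
Variables (M L : loopType) (f : M -> L).
Hypotheses (f_inj : injective f) (fM : {morph f : x y / x * y}).

Lemma IPL_embedding : IPL L -> IPL M.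
Proof.
move=> ipL; apply/IPL_cancel => x.
have [z [xz _] h] := ipL (f x).
have fz : f (ldiv x 1) = z.
  by apply: (@loop_mulI L (f x)); rewrite -fM mul_ldiv xz (morph_loop1 fM).
exists (ldiv x 1) => y.
by have [h1 h2] := h (f y); split; apply: f_inj; rewrite !fM fz.
Qed.

Lemma CCL_embedding : CCL L -> CCL M.
Proof.
move=> /CCL_conjugacy ccL; apply/CCL_conjugacy => x y v e t.
have [|h1 h2] := ccL (f x) (f y) (f v) _ (f t); first by rewrite -!fM e.
by split; apply: f_inj; rewrite !fM.
Qed.

End Embedding.

(** The whole loop, a subloop of itself, witnesses both conditions on subloops
    as soon as it is nontrivial. *)
Lemma IP_CC_SIP_SCCL_nontrivial (L : loopType) :
  IP_CC_SIP_SCCL L <-> [/\ IPL L, CCL L & exists x : L, x <> 1].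
Proof.
split=> [[ipL ccL [S [[x _ x1] _]] _] | [ipL ccL [x x1]]].
  by split=> //; exists x.
have nt : nontrivial (full_subloop L) by exists x.
have sval_inj : injective (sval : subloop_type (full_subloop L) -> L).
  by move=> u v; exact: sub_eq.
have svalM : {morph (sval : subloop_type (full_subloop L) -> L) : u v / u * v}.
  by [].
by split=> //; exists (full_subloop L); split=> //;
  [exact: IPL_embedding sval_inj svalM ipL
  |exact: CCL_embedding sval_inj svalM ccL].
Qed.

Section HolomorphTheory.
Variable L : loopType.

Definition holo_embed (x : L) : holomorph L := (aut1 L, x).

Lemma holo_embed_inj : injective holo_embed.
Proof. by move=> x y []. Qed.

Lemma holo_embedM : {morph holo_embed : x y / x * y}.
Proof. by move=> x y; congr pair; exact: aut_eq. Qed.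

Lemma holomorph_nontrivial :
  (exists u : holomorph L, u <> 1) <-> (exists x : L, x <> 1).
Proof.
split=> [[[a x] ax1] | [x x1]]; last by exists (holo_embed x) => -[].
apply: NNPP => trivL; apply: ax1.
have all1 (y : L) : y = 1 by apply: NNPP => y1; apply: trivL; exists y.
congr pair; last exact: all1.
by apply: aut_eq => y; rewrite [LHS]all1 [RHS]all1.
Qed.

Lemma IPL_holomorph : IPL L -> IPL (holomorph L).
Proof.
move=> /IPL_cancel ipL; apply/IPL_cancel => -[a x].
have [x' h] := ipL x; exists (aut_inv a, autinv a x') => -[b y].
split; congr pair.
- by apply: aut_eq => t /=; rewrite autinvK.
- (* The automorphism [b] sends the cancellation law for [x] to one for [b x]. *)
  rewrite /= autinvK -[y](autinvK b) -!autM.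
  by have [-> _] := h (autinv b y).
- by apply: aut_eq => t /=; rewrite autfK.
- apply: (can_inj (autfK a)); rewrite /= autM !autinvK.
  by have [_ ->] := h (a y).
Qed.

Lemma CCL_holomorph :
  IPL L -> nuclear_holomorph L -> CCL L -> CCL (holomorph L).
Proof.
move=> ipL nucL ccL; apply/CCL_conjugacy => -[a x] [b y] [d v] /= e [c t].
have e1 s : a (d s) = b (a s).
  by have := congr1 (fun u : holomorph L => autf u.1 s) e.
have e2 : a v * x = b x * y by exact: (congr1 snd e).
split; congr pair.
- by apply: aut_eq => s /=; rewrite e1.
- (* Second coordinates carry the factor [c], so [b] acts on [c x] through its
     conjugate by [c]. *)
  pose bc := aut_mul (aut_inv c) (aut_mul b c).
  have [n nuc sh] := nuclear_holomorph_shift (c x) bc ipL nucL.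
  have bcE : bc (c x) = c (b x) by rewrite /= autfK.
  rewrite bcE in sh.
  have e2c : c (a v) * c x = c (b x) * c y by rewrite -!autM e2.
  by have [-> _] := conjugacy_nuclear_shift t ccL nuc sh e2c.
- by apply: aut_eq => s /=; rewrite e1.
- have [n nuc sh] := nuclear_holomorph_shift x b ipL nucL.
  rewrite /= !autM e1.
  by have [_ ->] := conjugacy_nuclear_shift (b (a t)) ccL nuc sh e2.
Qed.

End HolomorphTheory.

Theorem theorem3p11 (L : loopType) (hinv : has_inverses L)
    (hnuc : nuclear_holomorph L) :
  IP_CC_SIP_SCCL L <-> IP_CC_SIP_SCCL (holomorph L).
Proof.
split=> /IP_CC_SIP_SCCL_nontrivial [ip cc nt];
  apply/IP_CC_SIP_SCCL_nontrivial; split.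
- exact: IPL_holomorph.
- exact: CCL_holomorph.
- exact/holomorph_nontrivial.
- exact: IPL_embedding (@holo_embed_inj L) (@holo_embedM L) ip.
- exact: CCL_embedding (@holo_embed_inj L) (@holo_embedM L) cc.
- exact/holomorph_nontrivial.
Qed.
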